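(* There is an absolute constant $c>0$ with the following property. Let $v\ge1$ and $\Delta\ge 0$ be integers and $0<\epsilon<1$, and set $K=\left\lfloor c\sqrt{\Delta}\ln\frac{v}{\epsilon}\right\rfloor$. Then there exists a function $\Phi=\Phi_{v,\Delta,\epsilon}$ of $K+1$ numbers, with nonzero values, such that for every graph $G$ with $v(G)=v$ vertices and largest vertex degree $\Delta(G)=\Delta$, the number $\Phi(m_0(G),m_1(G),\dots,m_K(G))$ approximates $M(G)$ within relative error $\epsilon$. In words: up to relative error $\epsilon$, $M(G)$ is determined by the numbers $m_k(G)$ with $k\le c\sqrt{\Delta(G)}\ln\frac{v(G)}{\epsilon}$.
   Context: Graphs are finite, undirected, without loops or multiple edges. A matching in $G$ is a set of pairwise vertex-disjoint edges; $m_k(G)$ is the number of matchings with exactly $k$ edges (so $m_0(G)=1$, and $m_k(G)=0$ for large $k$), and $M(G)=m_0(G)+m_1(G)+\cdots$ is the total number of matchings. $v(G)$ is the number of vertices and $\Delta(G)$ the largest degree of a vertex. For nonzero complex numbers $a,b$, $b$ approximates $a$ within relative error $\epsilon$ if $a=e^{z}$, $b=e^{w}$ for some complex $z,w$ with $|z-w|\le\epsilon$. *)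

(* Defs.v *)
From HB Require Import structures.
From mathcomp Require Import all_boot all_order all_algebra.
From mathcomp Require Import reals sequences exp trigo.
From mathcomp Require Import complex.

Set Implicit Arguments.
Unset Strict Implicit.
Unset Printing Implicit Defensive.

Import Order.TTheory GRing.Theory Num.Theory.

Section Graphs.
Variables (T : finType) (e : rel T).

(* A finite simple graph on the vertex set [T] is its adjacency relation. *)
Definition simple_graph := symmetric e /\ irreflexive e.

Definition degree (x : T) : nat := #|[set y | e x y]|.

Definition max_degree : nat := \max_(x : T) degree x.

Definition edges : {set {set T}} := [set [set x; y] | x in T, y in T & e x y].

Definition matching (M : {set {set T}}) : bool :=
  (M \subset edges) && trivIset M.

Definition nb_kmatchings (k : nat) : nat :=
  #|[set M : {set {set T}} | matching M & #|M| == k]|.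

Definition nb_matchings : nat := #|[set M : {set {set T}} | matching M]|.

Lemma nb_kmatchings0 : nb_kmatchings 0 = 1%N.
Proof.
rewrite /nb_kmatchings -(cards1 (set0 : {set {set T}})); apply: eq_card => M.
rewrite !inE cards_eq0; case: eqVneq => [->|_]; last by rewrite andbF.
rewrite /matching sub0set andbT /=; apply/trivIsetP => A B.
by rewrite inE.
Qed.

(* An upper bound [n] on the number of edges cuts the sum
   m_0 + m_1 + m_2 + ... without dropping nonzero terms. *)
Lemma nb_matchingsE n : #|edges| <= n ->
  nb_matchings = \sum_(0 <= k < n.+1) nb_kmatchings k.
Proof.
move=> len; rewrite /nb_matchings -sum1_card big_mkord.
rewrite (partition_big (fun M : {set {set T}} => inord #|M| : 'I_n.+1) predT) //.
apply: eq_bigr => k _; rewrite /nb_kmatchings -sum1_card.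
apply: eq_bigl => M; rewrite !inE.
have [/andP[sME _]|//] := boolP (matching M); rewrite /= -val_eqE /= inordK //.
by rewrite ltnS (leq_trans (subset_leq_card sME)).
Qed.

End Graphs.

Section Approximation.
Local Open Scope ring_scope.
Local Open Scope complex_scope.
Variable R : realType.

(* exp (x + i y) = exp x (cos y + i sin y) *)
Definition cexp (z : R[i]) : R[i] :=
  (expR (complex.Re z))%:C * (cos (complex.Im z) +i* sin (complex.Im z)).

Lemma cexpD (z w : R[i]) : cexp (z + w) = cexp z * cexp w.
Proof.
case: z w => [a b] [c d]; rewrite /cexp /= expRD cosD sinD rmorphM /=.
rewrite mulrACA; congr (_ * _); apply/eqP.
by rewrite eq_complex /= eqxx /= addrC eqxx.
Qed.

Definition approximates (eps : R) (a b : R[i]) : Prop :=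
  exists z w : R[i], [/\ a = cexp z, b = cexp w & `|z - w| <= eps%:C].

End Approximation.

(* Main.v *)
Require Import Defs.
From mathcomp Require Import all_boot all_order all_algebra ring lra.
From mathcomp Require Import reals sequences exp trigo.
From mathcomp Require Import boolp functions topology normedtype derive realfun.
From mathcomp Require Import complex.

(* By Heilmann-Lieb the matching polynomial sum_k m_k z^k factors as
   prod_i (1 + a_i z) with at most v factors and 0 <= a_i <= 4 Delta, so that
   ln M = sum_i ln (1 + a_i).  A polynomial Q of degree at most K, with
   Q(0) = 0, approximates ln (1 + x) within eps / (2 v) on [0, 4 Delta]: the
   rate of Chebyshev approximation of 1 / (1 + x) there is 1 + Delta^(-1/2),
   hence K of order sqrt Delta ln (v / eps) suffices, and one integrates.  By
   Newton's identities sum_i Q(a_i) depends only on m_0, ..., m_K; two graphs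
   with the same m_0, ..., m_K thus have ln M within eps of each other, and Phi
   may return the M of any one of them. *)

Set Implicit Arguments.
Unset Strict Implicit.
Unset Printing Implicit Defensive.

Import Order.TTheory GRing.Theory Num.Theory.
Import numFieldNormedType.Exports.
Local Open Scope ring_scope.
Local Open Scope complex_scope.

(** * Matchings inside vertex subsets *)

Section MatchingPolynomial.
Variables (T : finType) (e : rel T).
Hypothesis sg : simple_graph e.
Implicit Types (S : {set T}) (M : {set {set T}}).

(** Matchings of the subgraph induced on [S]; keeping the edges of the whole graph lets vertices be
    deleted by set difference within one type. *)
Definition matchings_in S := [set M | matching e M & cover M \subset S].

Definition matching_sum (F : comNzRingType) S (z : F) : F :=
  \sum_(M in matchings_in S) z ^+ #|M|.

Lemma edgesP (A : {set T}) :
  reflect (exists u w, e u w /\ A = [set u; w]) (A \in edges e).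
Proof.
apply: (iffP imset2P) => [[u w _]|[u [w [euw ->]]]].
  by rewrite inE => /andP[_ euw] ->; exists u, w.
by apply: (Imset2spec (x1 := u) (x2 := w)); rewrite ?inE.
Qed.

Lemma edge_set2 u w : ([set u; w] \in edges e) = e u w.
Proof.
have [sym irr] := sg.
apply/edgesP/idP => [[x [y [exy E]]]|euw]; last by exists u, w.
have xE : x \in [set u; w] by rewrite E !inE eqxx.
have yE : y \in [set u; w] by rewrite E !inE eqxx orbT.
move: xE yE; rewrite !inE => /orP[]/eqP xE /orP[]/eqP yE; move: exy;
  by rewrite xE yE ?irr // sym.
Qed.

Lemma matchingP M : reflect
  ((forall A, A \in M -> A \in edges e) /\
   (forall A B x, A \in M -> B \in M -> x \in A -> x \in B -> A = B))
  (matching e M).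
Proof.
apply: (iffP andP) => [[/subsetP sM /trivIsetP tM]|[sM tM]]; split => //.
- move=> A B x AM BM xA xB; apply/eqP/negPn/negP => nAB.
  by have /disjoint_setI0/setP/(_ x) := tM A B AM BM nAB; rewrite !inE xA xB.
- exact/subsetP.
- apply/trivIsetP => A B AM BM nAB; apply/pred0P => x /=; apply/negP.
  by case/andP => xA xB; rewrite (tM A B x) ?eqxx in nAB.
Qed.

Lemma edge_in_matching S M u : M \in matchings_in S -> u \in cover M ->
  exists w, [/\ [set u; w] \in M, w \in S & e u w].
Proof.
have [sym irr] := sg.
rewrite inE => /andP[/matchingP[sM _] /subsetP cM] /bigcupP[A AM uA].
have /edgesP[x [y [exy AE]]] := sM A AM.
have cS z : z \in A -> z \in S by move=> zA; apply: cM; apply/bigcupP; exists A.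
rewrite AE in AM uA cS *; move: uA; rewrite !inE => /orP[]/eqP ->.
  by exists y; split; rewrite ?cS ?inE ?eqxx ?orbT.
by exists x; split; rewrite 1?setUC ?cS ?inE ?eqxx ?orbT // sym.
Qed.

(** Removing the edge [[set u; w]] is a bijection onto the matchings of [S] without [u] and [w]. *)
Lemma sum_matchings_through (F : comNzRingType) (z : F) S u w :
  e u w -> u \in S -> w \in S ->
  \sum_(M in matchings_in S | [set u; w] \in M) z ^+ #|M| =
  z * matching_sum (S :\ u :\ w) z.
Proof.
move=> euw uS wS; set f := [set u; w].
have notf M : M \in matchings_in (S :\ u :\ w) -> f \notin M.
  rewrite inE => /andP[_ /subsetP cM]; apply/negP => fM.
  have /cM : u \in cover M by apply/bigcupP; exists f; rewrite // !inE eqxx.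
  by rewrite !inE eqxx andbF.
have fdis M A x : M \in matchings_in (S :\ u :\ w) -> A \in M -> x \in f ->
    x \in A -> False.
  rewrite inE => /andP[_ /subsetP cM] AM xf xA.
  have /cM : x \in cover M by apply/bigcupP; exists A.
  by move: xf; rewrite !inE => /orP[]/eqP->; rewrite eqxx ?andbF.
rewrite (reindex_onto (fun M => f |: M) (fun M => M :\ f)); last first.
  by move=> M /andP[_ fM]; rewrite setD1K.
rewrite /matching_sum mulr_sumr.
transitivity (\sum_(M in matchings_in (S :\ u :\ w)) z ^+ #|f |: M|); last first.
  by apply: eq_bigr => M MS; rewrite cardsU1 notf // add1n exprS.
apply: eq_bigl => M; apply/andP/idP => [[/andP[MS _] /eqP ME]|MS].
  have fM : f \notin M by rewrite -ME !inE eqxx.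
  move: MS; rewrite !inE => /andP[/matchingP[sM tM] /subsetP cM].
  apply/andP; split.
    apply/matchingP; split => [A AM|A B x AM BM].
      by apply: sM; rewrite inE AM orbT.
    by apply: tM; rewrite inE ?AM ?BM orbT.
  apply/subsetP => x /bigcupP[A AM xA]; rewrite !inE.
  have AfM : A \in f |: M by rewrite inE AM orbT.
  have ffM : f \in f |: M by rewrite !inE eqxx.
  have xS : x \in S by apply: cM; apply/bigcupP; exists A.
  rewrite xS andbT; apply/andP; split; apply: contra fM => /eqP xE;
    by rewrite -(tM A f x) //  xE !inE eqxx ?orbT.
split; last by rewrite setU1K ?eqxx ?notf.
rewrite setU11 andbT inE; have := MS.
rewrite inE => /andP[/matchingP[sM tM] /subsetP cM].
apply/andP; split; last first.
  apply/subsetP => x /bigcupP[A]; rewrite !inE => /orP[/eqP->|AM xA].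
    by rewrite !inE => /orP[]/eqP->.
  have /cM : x \in cover M by apply/bigcupP; exists A.
  by rewrite !inE => /andP[_ /andP[]].
apply/matchingP; split => [A|A B x].
  by rewrite !inE => /orP[/eqP->|/sM//]; rewrite edge_set2.
rewrite !in_setU1 => /orP[/eqP->|AM] /orP[/eqP->|BM] // xA xB.
- by case: (fdis M B x).
- by case: (fdis M A x).
- exact: tM xA xB.
Qed.

(** A matching of [S] either avoids [u] or pairs it with exactly one neighbour [w]; the latter kind
    is grouped by [w]. *)
Lemma matching_sum_rec (F : comNzRingType) (z : F) S u : u \in S ->
  matching_sum S z = matching_sum (S :\ u) z +
    z * \sum_(w in [set w in S | e u w]) matching_sum (S :\ u :\ w) z.
Proof.
move=> uS; rewrite /matching_sum.
rewrite (bigID (fun M => u \in cover M)) /= addrC; congr (_ + _).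
  apply: eq_bigl => M; rewrite !inE -andbA; congr (_ && _).
  by rewrite subsetD1.
(* [p M] is the partner of [u] in [M]; the default [u] never occurs when the matching [M] covers
   [u]. *)
pose p M := odflt u [pick w | [set u; w] \in M].
rewrite mulr_sumr (partition_big p [in [set w in S | e u w]]) /=; last first.
  move=> M /andP[MS uM]; have [w [fM wS euw]] := edge_in_matching MS uM.
  rewrite /p; case: pickP => [w' fM'|/(_ w)]; last by rewrite fM.
  suff <- : w = w' by rewrite inE wS.
  move: MS; rewrite inE => /andP[/matchingP[sM tM] _].
  have E := tM _ _ u fM fM' (set21 _ _) (set21 _ _).
  have [_ irr] := sg.
  have : w' \in [set u; w] by rewrite E set22.
  rewrite !inE => /orP[]/eqP // w'E; move: E; rewrite w'E setUid => /setP/(_ w).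
  by rewrite !inE eqxx orbT => /esym/eqP wu; rewrite wu irr in euw.
apply: eq_bigr => w; rewrite inE => /andP[wS euw].
rewrite -sum_matchings_through //; apply: eq_bigl => M.
have [MS|//] := boolP (M \in matchings_in S); rewrite /=.
apply/andP/idP => [[uM /eqP pM]|fM].
  move: pM; rewrite /p; case: pickP => [w' fM' /= <- //|no _].
  by have [w' []] := edge_in_matching MS uM; rewrite no.
split; first by apply/bigcupP; exists [set u; w]; rewrite ?set21.
rewrite /p; case: pickP => [w' fM'|/(_ w)]; last by rewrite fM.
move: MS; rewrite inE => /andP[/matchingP[sM tM] _] /=.
have E := tM _ _ u fM fM' (set21 _ _) (set21 _ _).
have euw' : e u w' by rewrite -edge_set2 sM.
have : w' \in [set u; w] by rewrite E set22.
rewrite !inE => /orP[]/eqP // w'E.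
by have [_ irr] := sg; rewrite w'E irr in euw'.
Qed.

Lemma matching_sum0 (F : comNzRingType) (z : F) : matching_sum set0 z = 1.
Proof.
rewrite /matching_sum (big_pred1 set0) ?cards0 // => M.
apply/idP/eqP => [|->]; last first.
  rewrite inE /cover big_set0 sub0set andbT.
  by apply/matchingP; split=> A; rewrite inE.
rewrite inE => /andP[/matchingP[sM _]]; rewrite subset0 => /eqP c0.
apply/setP => A; rewrite inE; apply/negP => AM.
have /edgesP[u [w [_ AE]]] := sM A AM.
have : u \in cover M by apply/bigcupP; exists A; rewrite // AE set21.
by rewrite c0 inE.
Qed.

(* With z = -1/x^2, the quotient y = x q(S) / q(S - u) of matching sums obeys
   y = x - sum_w 1/y_w, the sum running over the neighbours w of u in S. *)
Lemma matching_sum_neq0 (F : fieldType) (x : F) (P : F -> Prop) :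
  x != 0 -> (forall y, P y -> y != 0) ->
  (forall (A : {set T}) (y : T -> F), (#|A| <= max_degree e)%N ->
     (forall w, w \in A -> P (y w)) -> P (x - \sum_(w in A) (y w)^-1)) ->
  forall S, matching_sum S (- x ^- 2) != 0.
Proof.
move=> x0 P0 Prec S; pose q S' := matching_sum S' (- x ^- 2).
(* Nonvanishing alone does not propagate: the induction also carries [P] for all quotients at [S],
   which feed the recurrence one vertex higher up. *)
suff : q S != 0 /\ forall u, u \in S -> P (x * q S / q (S :\ u)) by case.
have [n] := ubnP #|S|; elim: n S => // n IH S; rewrite ltnS => leSn.
have step u : u \in S -> q S != 0 /\ P (x * q S / q (S :\ u)).
  move=> uS; have /IH[q0 IHu] : (#|S :\ u| < n)%N.
    by rewrite (cardsD1 u S) uS in leSn.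
  have PS : P (x * q S / q (S :\ u)).
    have -> : x * q S / q (S :\ u) =
        x - \sum_(w in [set w in S | e u w]) (x * q (S :\ u) / q (S :\ u :\ w))^-1.
      rewrite /q (matching_sum_rec _ uS) -/(q (S :\ u)) mulrDr mulrDl mulfK //.
      congr (_ + _); rewrite mulNr mulrN mulNr; congr (- _).
      rewrite [in LHS]mulr_sumr [in LHS]mulr_sumr [in LHS]mulr_suml.
      apply: eq_bigr => w _.
      by rewrite invf_div /q -/(q (S :\ u)); field; rewrite x0 q0.
    apply: Prec => [|w].
      apply: leq_trans (leq_bigmax u); apply: subset_leq_card.
      by apply/subsetP => w; rewrite !inE => /andP[].
    rewrite inE => /andP[wS euw]; apply: IHu; rewrite !inE wS andbT.
    by apply: contraTneq euw => ->; have [_ ->] := sg.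
  split=> //; have := P0 _ PS; apply: contraNneq => ->; by rewrite mulr0 mul0r.
split; last by move=> u /step[].
have [->|[u uS]] := set_0Vmem S; first by rewrite /q matching_sum0 oner_neq0.
by have [] := step u uS.
Qed.

End MatchingPolynomial.

(** * Power sums *)

Section Newton.
Variable F : fieldType.
Implicit Types s : seq F.

(** Its coefficients are the elementary symmetric functions e_k of [s]. *)
Definition recip_poly s : {poly F} := \prod_(a <- s) (1 + a *: 'X).

Definition power_sum k s : F := \sum_(a <- s) a ^+ k.

Lemma recip_poly_cons a s : recip_poly (a :: s) = (1 + a *: 'X) * recip_poly s.
Proof. by rewrite /recip_poly big_cons. Qed.

Lemma coef_recip_mul a (p : {poly F}) k :
  ((1 + a *: 'X) * p)`_k.+1 = p`_k.+1 + a * p`_k.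
Proof. by rewrite mulrDl mul1r -scalerAl coefD coefZ coefXM. Qed.

Lemma coef0_recip_mul a (p : {poly F}) : ((1 + a *: 'X) * p)`_0 = p`_0.
Proof. by rewrite mulrDl mul1r -scalerAl coefD coefZ coefXM mulr0 addr0. Qed.

Lemma coef_recip_poly0 s : (recip_poly s)`_0 = 1.
Proof.
elim: s => [|a s IH]; first by rewrite /recip_poly big_nil coef1.
by rewrite recip_poly_cons coef0_recip_mul.
Qed.

(** Newton's identities, by induction on [s]. Adding [a] contributes a e_k(s), by the power series
    division [quot]; the rest is the induction hypothesis at [k] and at [k - 1]. *)
Lemma newton_identity k s :
  (recip_poly s)`_k.+1 *+ k.+1 =
  \sum_(j < k.+1) (-1) ^+ j * power_sum j.+1 s * (recip_poly s)`_(k - j).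
Proof.
pose c s k := (recip_poly s)`_k; rewrite -/(c s _).
under eq_bigr do rewrite -/(c s _).
have c0 s' : c s' 0%N = 1 by exact: coef_recip_poly0.
have cS a s' n : c (a :: s') n.+1 = c s' n.+1 + a * c s' n.
  by rewrite /c recip_poly_cons coef_recip_mul.
(* Power series division of [recip_poly (a :: s)] by [1 + a X]. *)
have quot a s' n : c s' n = \sum_(j < n.+1) (- a) ^+ j * c (a :: s') (n - j)%N.
  elim: n => [|n IH].
    by rewrite big_ord1 subnn expr0 mul1r !c0.
  rewrite big_ord_recl subn0 expr0 mul1r.
  under eq_bigr do rewrite /= /bump /= add1n subSS exprS -mulrA.
  rewrite -mulr_sumr -IH cS.
  by rewrite mulNr addrK.
elim: s k => [|a s IH] k.
  rewrite [c _ _]/c /recip_poly big_nil coef1 mul0rn big1 // => j _.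
  by rewrite /power_sum big_nil mulr0 mul0r.
transitivity (\sum_(j < k.+1) (-1) ^+ j * a ^+ j.+1 * c (a :: s) (k - j)%N +
    \sum_(j < k.+1) (-1) ^+ j * power_sum j.+1 s * c (a :: s) (k - j)%N); last first.
  rewrite -big_split; apply: eq_bigr => j _ /=.
  by rewrite /power_sum big_cons; ring.
have -> : \sum_(j < k.+1) (-1) ^+ j * a ^+ j.+1 * c (a :: s) (k - j)%N = a * c s k.
  rewrite (quot a s k) mulr_sumr; apply: eq_bigr => j _.
  by rewrite [(- a) ^+ _]exprNn exprS; ring.
have -> : \sum_(j < k.+1) (-1) ^+ j * power_sum j.+1 s * c (a :: s) (k - j)%N =
   c s k.+1 *+ k.+1 + a * (c s k *+ k).
  rewrite IH; case: k => [|k].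
    by rewrite !big_ord1 subnn !c0 mulr0n mulr0 addr0.
  rewrite IH mulr_sumr [in LHS]big_ord_recr [in X in _ = X + _]big_ord_recr /=.
  rewrite subnn !c0.
  rewrite addrAC; congr (_ + _); rewrite -big_split; apply: eq_bigr => j _ /=.
  by rewrite subSn -1?ltnS // cS; ring.
by rewrite cS mulrS mulrnDl mulrS -mulr_natr; ring.
Qed.

(** The last term of Newton's identity is, up to sign, p_{k+1} e_0 with e_0 = 1, so each power sum
    follows from the earlier ones and the coefficients, without division. *)
Lemma eq_power_sum n s t :
  (forall k, (k <= n)%N -> (recip_poly s)`_k = (recip_poly t)`_k) ->
  forall k, (0 < k <= n)%N -> power_sum k s = power_sum k t.
Proof.
move=> E; elim/ltn_ind => -[//|k] IH /= kn.
have := newton_identity k s; rewrite E // newton_identity !big_ord_recr /= subnn.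
rewrite !coef_recip_poly0 !mulr1 => /eqP; rewrite (eq_bigr (fun j : 'I_k =>
  (-1) ^+ j * power_sum j.+1 s * (recip_poly s)`_(k - j))).
  by rewrite (inj_eq (addrI _)) (can_eq (signrMK _)) => /eqP.
move=> j _; rewrite IH ?E //; first by rewrite (leq_trans (leq_subr _ _)) // ltnW.
by rewrite ltnS.
by rewrite (leq_trans (ltn_ord j)) // ltnW.
Qed.

End Newton.

(** * Roots of the matching polynomial *)

Section HeilmannLieb.
Variables (R : realType) (T : finType) (e : rel T).
Hypothesis sg : simple_graph e.

(** The positive form sum_k m_k z^k, not the alternating one. The ring is a parameter because roots
    are taken in [R[i]] while the factorisation is wanted over [R]. *)
Definition matching_poly (F : comNzRingType) : {poly F} :=
  \sum_(M in matchings_in e setT) 'X^#|M|.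

Lemma in_matchings_inT M : (M \in matchings_in e setT) = matching e M.
Proof. by rewrite inE subsetT andbT. Qed.

Lemma horner_matching_poly (F : comNzRingType) (z : F) :
  (matching_poly F).[z] = matching_sum e setT z.
Proof. by rewrite horner_sum; apply: eq_bigr => M _; rewrite hornerXn. Qed.

Lemma coef_matching_poly (F : comNzRingType) k :
  (matching_poly F)`_k = (nb_kmatchings e k)%:R.
Proof.
rewrite coef_sum /nb_kmatchings -sum1_card natr_sum big_mkcond [RHS]big_mkcond.
apply: eq_bigr => M _; rewrite in_matchings_inT inE.
by case: (matching e M); rewrite ?coefXn //= eq_sym; case: eqP.
Qed.

Lemma matching_poly1 (F : comNzRingType) :
  (matching_poly F).[1] = (nb_matchings e)%:R.
Proof.
rewrite horner_sum /nb_matchings -sum1_card natr_sum.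
by apply: eq_big => M; rewrite ?in_matchings_inT ?inE // hornerXn expr1n.
Qed.

Lemma card_matching M : matching e M -> (#|M| <= #|T|)%N.
Proof.
case/andP => /subsetP sM /eqP cM; rewrite (leq_trans _ (max_card (cover M))) //.
rewrite -cM -sum1_card leq_sum // => A /sM /(edgesP _ _)[u [w [_ ->]]].
by rewrite card_gt0; apply/set0Pn; exists u; rewrite set21.
Qed.

Lemma size_matching_poly (F : comNzRingType) :
  (size (matching_poly F) <= #|T|.+1)%N.
Proof.
apply: leq_trans (size_sum _ _ _) _; apply/bigmax_leqP => M.
by rewrite in_matchings_inT size_polyXn ltnS => /card_matching.
Qed.

(** Any root is r = -1/x^2 with x a complex square root of -1/r. Two choices of the stable set [P]
    in [matching_sum_neq0] show that x is real and that x^2 <= 4 Delta. *)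
Lemma matching_root_recip (r : R[i]) : root (matching_poly R[i]) r ->
  exists2 a : R, 0 <= a <= 4%:R * (max_degree e)%:R & - r^-1 = a%:C.
Proof.
set D := max_degree e => /rootP r0.
have rn0 : r != 0.
  apply: contra_eq_neq r0 => ->.
  by rewrite horner_coef0 coef_matching_poly nb_kmatchings0 oner_eq0.
pose x := sqrtc (- r^-1).
have x2 : x ^+ 2 = - r^-1 by rewrite sqr_sqrtc.
have rE y : y ^+ 2 = x ^+ 2 -> r = - y ^- 2.
  by move=> ->; rewrite x2 invrN invrK opprK.
have xn0 : x != 0 by rewrite -sqrf_eq0 x2 oppr_eq0 invr_eq0.
have nroot y : y ^+ 2 = x ^+ 2 -> matching_sum e setT (- y ^- 2) = 0.
  by move=> /rE <-; rewrite -horner_matching_poly.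
(* The open upper half plane is stable under y |-> x - sum_w 1/y_w. *)
have upper y : y ^+ 2 = x ^+ 2 -> ~ 0 < complex.Im y.
  move=> yx yI.
  have ImV (z : R[i]) : 0 < complex.Im z -> complex.Im z^-1 < 0.
    case: z => a b /= b0; rewrite ?mulNr oppr_lt0 divr_gt0 //.
    by rewrite ltr_wpDl ?sqr_ge0 // exprn_gt0.
  have := @matching_sum_neq0 T e sg R[i] y (fun z => 0 < complex.Im z).
  move=> /(_ _ _ _ setT); rewrite nroot // eqxx => H; apply/negP: isT; apply: H.
  - by rewrite -sqrf_eq0 yx sqrf_eq0.
  - by move=> z; apply: contraTneq => ->; rewrite ltxx.
  - move=> A z _ zP; rewrite raddfB /= subr_gt0 (le_lt_trans _ yI) //.
    by rewrite raddf_sum sumr_le0 // => w /zP /ImV /ltW.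
have xI : complex.Im x = 0.
  apply/eqP; rewrite eq_le !leNgt; apply/andP; split; apply/negP; first exact: upper.
  (* [- x] has the same square, so the lower half plane reduces to the upper one. *)
  by move=> xI; apply: (upper (- x)); rewrite ?sqrrN // raddfN oppr_gt0.
pose y : R := `|complex.Re x|.
have yx : y%:C ^+ 2 = x ^+ 2.
  rewrite -rmorphXn /= real_normK ?num_real // rmorphXn /=; congr (_ ^+ 2).
  by case: (x) xI => a b /= ->.
have y0 : 0 < y.
  rewrite lt_def normr_ge0 andbT; apply: contra_neq xn0 => y0.
  by apply/eqP; rewrite -sqrf_eq0 -yx y0 expr0n.
exists (y ^+ 2); last by rewrite rmorphXn /= yx x2.
rewrite sqr_ge0 /= leNgt; apply/negP => yD.
(* For y >= 2 sqrt D, reals above y/2 are stable under y - sum_w 1/y_w. *)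
have := @matching_sum_neq0 T e sg R[i] y%:C (fun z => (y / 2%:R)%:C <= z).
move=> /(_ _ _ _ setT); rewrite nroot // eqxx => H; apply/negP: isT; apply: H.
- by rewrite eq_complex /= eqxx andbT gt_eqF.
- move=> z; apply: contraTneq => ->; rewrite lecR.
  by rewrite -ltNge divr_gt0.
- move=> A z AD zP.
  have y20 : 0 < (y / 2%:R)%:C by rewrite ltcR divr_gt0.
  have le_sum : \sum_(w in A) (z w)^-1 <= ((2%:R / y) *+ D)%:C.
    apply: (@le_trans _ _ (\sum_(w in A) (2%:R / y)%:C)).
      apply: ler_sum => w /zP le; rewrite -invf_div fmorphV.
      by rewrite lef_pV2 ?posrE // (lt_le_trans y20).
    rewrite sumr_const -rmorphMn lecR -(mulr_natr _ #|A|) -(mulr_natr _ D).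
    by rewrite ler_wpM2l ?ler_nat // divr_ge0 // ltW // y0.
  rewrite lerBrDr (le_trans (lerD (lexx _) le_sum)) // -rmorphD lecR.
  rewrite -mulr_natr -/D mulrAC.
  (* This is the bound y^2 >= 4 D; it gives y - 2 D / y >= y / 2. *)
  have : 2%:R * D%:R / y <= y / 2%:R by rewrite ler_pdivrMr //; nra.
  by lra.
Qed.

(** Over [R[i]] the polynomial splits, and every -1/r is real by [matching_root_recip]. The constant
    coefficient 1 allows the factors to be normalised as 1 - X/r, and the identity descends to [R]
    because the embedding is injective. *)
Lemma heilmann_lieb : exists s : seq R,
  [/\ (size s <= #|T|)%N,
      {in s, forall a, 0 <= a <= 4%:R * (max_degree e)%:R} &
      matching_poly R = recip_poly s].
Proof.
have [rs rsE] := closed_field_poly_normal (matching_poly R[i]).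
set p := matching_poly R[i] in rsE.
have p00 : p`_0 = 1 by rewrite coef_matching_poly nb_kmatchings0.
have p0 : p != 0 by apply: contraNneq (oner_neq0 R[i]) => pE; rewrite -p00 pE coef0.
have rsP r : r \in rs -> root p r.
  move=> rrs; rewrite rsE rootZ ?lead_coef_eq0 //.
  by rewrite root_prod_XsubC.
pose s := [seq complex.Re (- r^-1) | r <- rs].
have sE r : r \in rs -> r != 0 /\ - r^-1 = (complex.Re (- r^-1))%:C.
  move=> /rsP rp; have [a _ ->] := matching_root_recip rp; split=> //.
  by apply: contraTneq rp => ->; rewrite rootE horner_coef0 p00 oner_eq0.
exists s; split.
- rewrite size_map -ltnS (leq_trans _ (size_matching_poly R[i])) // -/p.
  by rewrite rsE size_scale ?lead_coef_eq0 // size_prod_XsubC.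
- by move=> _ /mapP[r /rsP /matching_root_recip[a aD ->] ->].
apply: (@map_poly_inj _ _ (real_complex R : {rmorphism R -> R[i]})).
have -> : map_poly (real_complex R) (matching_poly R) = p.
  by rewrite rmorph_sum; apply: eq_bigr => M _ /=; rewrite map_polyXn.
have mapE a : map_poly (real_complex R) (1 + a *: 'X) = 1 + a%:C *: 'X.
  by rewrite rmorphD rmorph1 /= map_polyZ map_polyX.
have -> : map_poly (real_complex R) (recip_poly s) =
    \prod_(r <- rs) (- r^-1 *: ('X - r%:P)).
  rewrite rmorph_prod big_map big_seq [in RHS]big_seq; apply: eq_bigr => r /sE[r0 rE].
  transitivity (1 + (complex.Re (- r^-1))%:C *: 'X); first exact: mapE.
  rewrite -rE scalerBr addrC.
  by rewrite -scaleNr opprK -(mul_polyC r^-1) -polyCM mulVf.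
rewrite scaler_prod; rewrite {1}rsE; congr (_ *: _).
(* The constant coefficient 1 forces the leading coefficient to be the product of the -1/r. *)
have := p00; rewrite rsE coefZ -horner_coef0 horner_prod.
have -> : \prod_(r <- rs) ('X - r%:P).[0] = \prod_(r <- rs) (- r).
  by apply: eq_bigr => r _; rewrite !hornerE.
have E : (\prod_(r <- rs) - r^-1) * (\prod_(r <- rs) (- r)) = 1.
  rewrite -big_split big1_seq // => r /= /sE[r0 _].
  by rewrite mulrNN mulVf.
move=> /(congr1 ( *%R (\prod_(r <- rs) - r^-1))); rewrite mulrCA E !mulr1.
by rewrite -rsE.
Qed.

End HeilmannLieb.

(** * Chebyshev approximation of the logarithm *)

Section Chebyshev.
Variable R : realType.

(** The pair (T_n, T_{n+1}): carrying both makes the two-step recurrence structural. *)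
Fixpoint chebyshev_pair n : {poly R} * {poly R} :=
  if n is n'.+1 then
    let: (p, q) := chebyshev_pair n' in (q, 2%:R *: 'X * q - p)
  else (1, 'X).

Definition chebyshev n : {poly R} := (chebyshev_pair n).1.

Lemma chebyshevSS n :
  chebyshev n.+2 = 2%:R *: 'X * chebyshev n.+1 - chebyshev n.
Proof. by rewrite /chebyshev /=; case: (chebyshev_pair n). Qed.

Lemma chebyshev_ind (P : nat -> {poly R} -> Prop) :
  P 0%N 1 -> P 1%N 'X ->
  (forall n p q, P n p -> P n.+1 q -> P n.+2 (2%:R *: 'X * q - p)) ->
  forall n, P n (chebyshev n).
Proof.
move=> P0 P1 PSS n; suff [] : P n (chebyshev n) /\ P n.+1 (chebyshev n.+1) by [].
by elim: n => [|n [Pn PnS]]; split => //; rewrite chebyshevSS; exact: PSS.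
Qed.

Lemma size_chebyshev n : (size (chebyshev n) <= n.+1)%N.
Proof.
move: n; apply: (@chebyshev_ind (fun n p => (size p <= n.+1)%N)) => [||n p q sp sq];
  rewrite ?size_poly1 ?size_polyX //.
rewrite (leq_trans (size_polyD _ _)) // size_polyN geq_max; apply/andP; split; last first.
  exact: leqW (leqW sp).
rewrite -scalerAl (leq_trans (size_scale_leq _ _)) // (leq_trans (size_polyMleq _ _)) //.
by rewrite size_polyX.
Qed.

Lemma chebyshev_cos n (x : R) : (chebyshev n).[cos x] = cos (x *+ n).
Proof.
move: n; apply: (@chebyshev_ind (fun n p => p.[cos x] = cos (x *+ n))) => [||n p q ep eq];
  rewrite ?hornerE ?mulr0n ?cos0 //.
rewrite ep eq; have -> : x *+ n = x *+ n.+1 - x by rewrite mulrS addrAC subrr add0r.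
by rewrite cosB [x *+ n.+2]mulrS cosD; ring.
Qed.

Lemma chebyshev_le1 n (x : R) : -1 <= x <= 1 -> `|(chebyshev n).[x]| <= 1.
Proof. by move=> x1; rewrite -[x]acosK ?in_itv //= chebyshev_cos cos_max. Qed.

(** The counterpart of [chebyshev_cos] outside [-1, 1]: for w > 1 it shows growth like w^n / 2. *)
Lemma chebyshev_joukowski n (w : R) : w != 0 ->
  (chebyshev n).[(w + w^-1) / 2%:R] = (w ^+ n + w ^- n) / 2%:R.
Proof.
move=> w0; move: n; apply: (@chebyshev_ind (fun n p =>
  p.[(w + w^-1) / 2%:R] = (w ^+ n + w ^- n) / 2%:R)) => [||n p q Ep Eq].
- by rewrite hornerC !expr0 invr1; field.
- by rewrite hornerX.
- rewrite !(hornerD, hornerN, hornerM, hornerZ, hornerX) Ep Eq !exprS.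
  by field; rewrite w0 expf_neq0.
Qed.

(* The affine map taking [0, b] onto [-1, 1] and -1 to (w + 1/w)/2 turns T_n
   into a polynomial which is at most 1 on [0, b] but large at -1; normalised
   to 1 at -1, it is the residual 1 - (1 + t) q(t). *)
Lemma approx_inv n (w b : R) : 1 < w -> b = 4%:R * w / (w - 1) ^+ 2 ->
  exists q : {poly R}, (size q <= n)%N /\
    forall t : R, 0 <= t <= b -> `|(1 + t)^-1 - q.[t]| <= 2%:R * w ^- n.
Proof.
move=> w1 bE; have w0 : 0 < w by lra.
have wm1 : w - 1 != 0 by lra.
have b0 : 0 < b by rewrite bE divr_gt0 ?mulr_gt0 ?exprn_gt0 //; lra.
pose J := (w + w^-1) / 2%:R.
pose l : {poly R} := 1%:P - (2%:R / b) *: 'X.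
pose tn := (w ^+ n + w ^- n) / 2%:R.
have wn0 : 0 < w ^+ n by rewrite exprn_gt0.
have tn0 : 0 < tn by rewrite divr_gt0 ?addr_gt0 ?invr_gt0.
pose r : {poly R} := tn^-1 *: (chebyshev n \Po l).
have lE t : l.[t] = 1 - 2%:R / b * t by rewrite /l !hornerE.
have r1 : r.[-1] = 1.
  rewrite /r hornerZ horner_comp lE.
  (* Solving 1 + 2/b = (w + 1/w)/2 is what gives the value of [b]. *)
  have -> : 1 - 2%:R / b * -1 = J by rewrite bE /J; field; rewrite wm1 gt_eqF.
  by rewrite chebyshev_joukowski ?gt_eqF // -/tn mulVf ?gt_eqF.
have rle (t : R) : 0 <= t <= b -> `|r.[t]| <= 2%:R * w ^- n.
  move=> /andP[t0 tb]; rewrite /r hornerZ normrM horner_comp lE.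
  have tb1 : t / b <= 1 by rewrite ler_pdivrMr ?mul1r.
  have tb0 : 0 <= t / b by rewrite divr_ge0 // ltW.
  have /(chebyshev_le1 n) le1 : -1 <= 1 - 2%:R / b * t <= 1.
    by rewrite mulrAC -mulrA; apply/andP; split; lra.
  rewrite (le_trans (ler_wpM2l _ le1)) // mulr1 gtr0_norm ?invr_gt0 //.
  rewrite /tn invf_div ler_pM2l // lef_pV2 ?posrE ?addr_gt0 ?invr_gt0 //.
  by rewrite lerDl invr_ge0 ltW.
have : root (1 - r) (-1) by rewrite rootE hornerD hornerN r1 -polyC1 hornerC subrr.
case/factor_theorem => q; rewrite polyCN opprK => qE.
have size_r : (size (1 - r)%R <= n.+1)%N.
  rewrite (leq_trans (size_polyD _ _)) // size_polyN geq_max size_poly1 /=.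
  rewrite (leq_trans (size_scale_leq _ _)) // (leq_trans (size_comp_poly_leq _ _)) //.
  rewrite ltnS -[leqRHS]muln1 leq_mul //; last first.
    have : (size l <= 2)%N.
      rewrite (leq_trans (size_polyD _ _)) // size_polyN geq_max size_polyC.
      rewrite (leq_trans (leq_b1 _)) //.
      by rewrite (leq_trans (size_scale_leq _ _)) // size_polyX.
    by case: (size l) => [|[|[]]].
  by have := size_chebyshev n; case: (size _).
exists q; split.
  have [->|q0] := eqVneq q 0; first by rewrite size_poly0.
  by move: size_r; rewrite qE polyC1 size_Mmonic ?monicXaddC // size_XaddC addn2.
move=> t tb; have t1 : 1 + t != 0 by case/andP: tb => t0 _; lra.
have /(congr1 (fun p => p.[t])) := qE.
rewrite hornerD hornerN hornerM hornerD hornerX -polyC1 !hornerC => E.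
(* The factor 1 / (1 + t) is at most 1 for t >= 0, so a bound on [r] bounds the error. *)
have -> : (1 + t)^-1 - q.[t] = r.[t] / (1 + t).
  have -> : r.[t] = 1 - q.[t] * (t + 1) by rewrite -E; ring.
  by field.
rewrite normrM (le_trans _ (rle t tb)) // ler_piMr // normfV invf_le1 ?normr_gt0 //.
by case/andP: tb => t0 _; rewrite ger0_norm; lra.
Qed.

(** At [i = 0] the quotient by zero is 0, hence there is no constant term. *)
Definition primitive_poly (q : {poly R}) : {poly R} :=
  \poly_(i < (size q).+1) (q`_i.-1 / i%:R).

Lemma primitive_poly0 q : (primitive_poly q).[0] = 0.
Proof. by rewrite horner_coef0 coef_poly /= invr0 mulr0. Qed.

Lemma deriv_primitive q : (primitive_poly q)^`() = q.
Proof.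
apply/polyP => i; rewrite coef_deriv coef_poly ltnS; case: ltnP => qi.
  by rewrite -[LHS]mulr_natr divfK ?pnatr_eq0.
by rewrite mul0rn nth_default.
Qed.

(** Mean value theorem for ln (1 + t) - Q(t), which vanishes at 0 and whose derivative is the
    difference bounded by [d]. *)
Lemma approx_ln (q : {poly R}) (d b : R) :
  (forall t : R, 0 <= t <= b -> `|(1 + t)^-1 - q.[t]| <= d) ->
  forall x : R, 0 <= x <= b -> `|ln (1 + x) - (primitive_poly q).[x]| <= d * x.
Proof.
move=> qd x /andP[x0 xb]; set Q := primitive_poly q.
pose f : R -> R := (@ln R \o shift 1) - horner Q.
have df (t : R) : 0 <= t -> is_derive t 1 f ((1 + t)^-1 - q.[t]).
  move=> t0; have lt : 0 < t + 1 by lra.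
  have D := @is_derive1_comp R (@ln R) (shift 1) t _ _ (is_derive1_ln lt)
    (is_derive_shift t 1 1).
  rewrite -[in q.[t]](deriv_primitive q).
  by apply: trigger_derive; rewrite mulr1 [t + 1]addrC.
have [t|c|c cI] := @MVT_segment R f (fun t => (1 + t)^-1 - q.[t]) 0 x x0.
- by rewrite in_itv /= => /andP[/ltW t0 _]; exact: df.
- apply: derivable_within_continuous => t; rewrite in_itv /= => /andP[t0 _].
  by have [] := df t t0.
have -> : f 0 = 0 by rewrite /f !fctE /= add0r ln1 primitive_poly0 subrr.
have -> : f x = ln (1 + x) - Q.[x] by rewrite /f !fctE /= [1 + x]addrC.
rewrite !subr0 => ->.
move: cI; rewrite in_itv /= => /andP[c0 cx].
by rewrite normrM (ger0_norm x0) ler_wpM2r // qd // c0 /= (le_trans cx).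
Qed.

End Chebyshev.

(** * The number of matchings *)

Section Approx.
Variable R : realType.

(** From exp (-y/2) >= 1 - y/2 and (1 + y) (1 - y/2) >= 1 on [0, 1]. It turns powers of the
    Chebyshev rate 1 + y into exponentials. *)
Lemma expR_half_le1D (y : R) : 0 <= y <= 1 -> expR (y / 2%:R) <= 1 + y.
Proof.
move=> /andP[y0 y1]; rewrite -[y / 2%:R]opprK expRN -[leRHS]invrK.
have y1p : 0 < 1 + y by lra.
rewrite lef_pV2 ?posrE ?invr_gt0 ?expR_gt0 //.
apply: le_trans (expR_ge1Dx _); rewrite -div1r ler_pdivrMr //; nra.
Qed.

Lemma expR_half_le2 : expR (2%:R^-1 : R) <= 2%:R.
Proof. by have := @expR_half_le1D 1; rewrite div1r ler01 lexx => /(_ isT); lra. Qed.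

Lemma max_degree_lt (T : finType) (e : rel T) :
  irreflexive e -> (0 < #|T|)%N -> (max_degree e < #|T|)%N.
Proof.
move=> irr T0; case: (@bigop.eq_bigmax _ (degree e)) => // x; rewrite -/(max_degree e) => ->.
apply: (leq_trans (n := #|[set: T]|)); last by rewrite cardsT.
apply: proper_card; apply/properP; split; first exact: subsetT.
by exists x; rewrite !inE ?irr.
Qed.

Lemma approx_ln_bounded (v D : nat) (eps : R) : (0 < D < v)%N -> 0 < eps < 1 ->
  exists Q : {poly R},
    [/\ (size Q <=
          (Num.truncn (14%:R * Num.sqrt D%:R * ln (v%:R / eps))).+1)%N,
        Q.[0] = 0 &
     forall x : R, 0 <= x <= 4%:R * D%:R ->
       `|ln (1 + x) - Q.[x]| <= eps / (2%:R * v%:R)].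
Proof.
move=> /andP[D0 Dv] /andP[eps0 eps1].
set L := ln _; set K := Num.truncn _.
(* With w = 1 + 1/sqrt D the interval of [approx_inv] is [0, 4 D w], which contains [0, 4 D]. *)
pose d : R := Num.sqrt D%:R; pose y := d^-1; pose w := 1 + y.
have d1 : 1 <= d by rewrite -sqrtr1 ler_sqrt ?ler1n ?ler0n.
have d2 : d ^+ 2 = D%:R by rewrite sqr_sqrtr ?ler0n.
have d0 : 0 < d by lra.
have y0 : 0 < y by rewrite invr_gt0.
have y1 : y <= 1 by rewrite invf_le1.
have v2 : 2%:R <= v%:R :> R by rewrite ler_nat; apply: leq_ltn_trans D0 Dv.
have DvR : D%:R <= v%:R :> R by rewrite ler_nat ltnW.
have ve0 : 0 < v%:R / eps by rewrite divr_gt0 //; lra.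
have LE : expR L = v%:R / eps by rewrite lnK.
have veps : 2%:R <= v%:R / eps by rewrite ler_pdivlMr //; nra.
have L2 : 2%:R^-1 <= L.
  by rewrite -(ler_expR) LE (le_trans expR_half_le2).
have Kgt : 14%:R * d * L < K.+1%:R.
  by rewrite -truncn_lt_nat // !mulr_ge0 ?ler0n; lra.
have w1 : 1 < w by rewrite /w; lra.
have [q [sq qP]] := approx_inv K w1 erefl.
have bE : 4%:R * w / (w - 1) ^+ 2 = 4%:R * D%:R * w.
  by rewrite /w -d2 /y; field; rewrite gt_eqF //= ; lra.
exists (primitive_poly q); split.
- by rewrite (leq_trans (size_poly _ _)).
- exact: primitive_poly0.
(* This is enough, since the error is at most 2 w^(-K) x with x <= 4 D <= 4 v. *)
have wK : 16%:R * v%:R ^+ 2 / eps <= w ^+ K.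
  (* Origin of 14: K + 1 > 14 d L and y <= 1 give K y / 2 >= 7 L - 1/2 >= 6 L, because L >= 1/2. *)
  have wexp : expR (6%:R * L) <= w ^+ K.
    have wy : expR (y / 2%:R) ^+ K <= w ^+ K.
      rewrite lerXn2r ?nnegrE ?expR_ge0 ?expR_half_le1D ?y1 ?andbT ?(ltW y0) //.
      by rewrite /w; lra.
    apply: le_trans wy.
    rewrite -expRM_natl ler_expR.
    have : (14%:R * d * L) * y <= (K%:R + 1) * y.
      by rewrite ler_wpM2r 1?ltW //; move: Kgt; rewrite -natr1; lra.
    have -> : 14%:R * d * L * y = 14%:R * L by rewrite /y; field; rewrite gt_eqF.
    by lra.
  apply: le_trans wexp; rewrite expRM_natl LE.
  set u := v%:R / eps in veps *.
  have -> : 16%:R * v%:R ^+ 2 / eps = 16%:R * u ^+ 2 * eps.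
    by rewrite /u; field; rewrite gt_eqF.
  (* From u >= 2 and eps < 1: u^6 >= 16 u^2 >= 16 u^2 eps. *)
  have u4 : 16%:R <= u ^+ 4.
    by rewrite (_ : 16%:R = 2%:R ^+ 4 :> R) ?lerXn2r ?nnegrE ?ler0n //; [lra|ring].
  have u2 : 0 <= u ^+ 2 by rewrite sqr_ge0.
  rewrite (_ : u ^+ 6 = u ^+ 4 * u ^+ 2); last by ring.
  by nra.
move=> x xD; have D1 : 1 <= D%:R :> R by rewrite ler1n.
have xb : 0 <= x <= 4%:R * w / (w - 1) ^+ 2.
  rewrite bE; case/andP: xD => -> /le_trans; apply.
  by rewrite ler_peMr ?mulr_ge0 ?ler0n // lerDl ltW.
apply: le_trans (approx_ln qP xb) _.
have wK0 : 0 < w ^+ K by rewrite exprn_gt0 // /w; lra.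
have vp : 0 < v%:R :> R by rewrite (lt_le_trans _ v2).
rewrite mulrAC ler_pdivrMr // mulrAC ler_pdivlMr ?mulr_gt0 //.
move: wK; rewrite ler_pdivrMr // [w ^+ K * _]mulrC => wK.
by apply: le_trans wK; case/andP: xD => x0 xD; nra.
Qed.

(** As Q(0) = 0, the sum starts at 1: the power sum of index 0 is the length of [s], which the
    coefficients of [recip_poly s] do not determine. *)
Lemma sum_horner_power_sum (Q : {poly R}) (s : seq R) n : (size Q <= n.+1)%N ->
  Q.[0] = 0 -> \sum_(a <- s) Q.[a] = \sum_(1 <= i < n.+1) Q`_i * power_sum i s.
Proof.
move=> sQ Q0; under eq_bigr do rewrite (horner_coef_wide _ sQ).
rewrite exchange_big /= -(big_mkord predT (fun i => \sum_(a <- s) Q`_i * a ^+ i)).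
rewrite [LHS]big_ltn //= [X in X + _]big1 ?add0r.
  by apply: eq_bigr => i _; rewrite mulr_sumr.
by move=> a _; rewrite -horner_coef0 Q0 mul0r.
Qed.

Lemma ln_recip_poly1 (s : seq R) : {in s, forall a, 0 <= a} ->
  0 < (recip_poly s).[1] /\ ln (recip_poly s).[1] = \sum_(a <- s) ln (1 + a).
Proof.
elim: s => [|a s IH] s0; first by rewrite /recip_poly !big_nil hornerC ln1.
have a0 : 0 < 1 + a by have := s0 a (mem_head _ _); lra.
case: IH => [b bs|IH0 IHln]; first by rewrite s0 // inE bs orbT.
rewrite recip_poly_cons hornerM hornerD hornerZ hornerX -polyC1 hornerC mulr1.
by rewrite mulr_gt0 // big_cons lnM ?posrE // IHln.
Qed.

(** Each logarithm is within eps/2 of the sum of Q over its list, and the two sums of Q coincide by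
    [eq_power_sum]. *)
Lemma ln_nb_matchings_close (v D : nat) (eps : R) (T T' : finType)
    (e : rel T) (e' : rel T') :
  0 < eps < 1 -> simple_graph e -> simple_graph e' ->
  #|T| = v -> #|T'| = v -> max_degree e = D -> max_degree e' = D ->
  (forall k, (k <= Num.truncn (14%:R * Num.sqrt D%:R * ln (v%:R / eps)))%N ->
     nb_kmatchings e k = nb_kmatchings e' k) ->
  `|ln (nb_matchings e)%:R - ln (nb_matchings e')%:R| <= eps.
Proof.
set K := Num.truncn _ => eps01 sg sg' Tv Tv' eD eD' eqm.
have [eps0 eps1] := andP eps01.
have [s [ss sP sE]] := heilmann_lieb R sg.
have [s' [ss' sP' sE']] := heilmann_lieb R sg'.
rewrite -!matching_poly1 sE sE'.
have /ln_recip_poly1[_ ->] : {in s, forall a, 0 <= a} by move=> a /sP/andP[].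
have /ln_recip_poly1[_ ->] : {in s', forall a, 0 <= a} by move=> a /sP'/andP[].
have [Q [sQ Q0 QP]] : exists Q : {poly R}, [/\ (size Q <= K.+1)%N, Q.[0] = 0 &
     forall x : R, 0 <= x <= 4%:R * D%:R ->
       `|ln (1 + x) - Q.[x]| <= eps / (2%:R * v%:R)].
  (* For D = 0 every [a] is 0 and Q = 0 is exact; the rate 1 + 1/sqrt D needs D > 0. *)
  have [D0|Dpos] := posnP D.
    exists 0; rewrite size_poly0 hornerC; split=> // x.
    rewrite D0 mulr0 -eq_le => /eqP <-.
    by rewrite addr0 ln1 hornerC subrr normr0 divr_ge0 ?mulr_ge0 ?ler0n // ltW.
  apply: approx_ln_bounded => //; rewrite Dpos -eD -Tv max_degree_lt //.
    by have [] := sg.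
  rewrite lt0n; apply: contraTneq Dpos => /card0_eq T0; rewrite -eD -leqNgt.
  by apply/bigmax_leqP => x; have := T0 x; rewrite inE.
(* There are at most v terms, each off by at most eps / (2 v). *)
have err (t : seq R) : (size t <= v)%N ->
    {in t, forall a, 0 <= a <= 4%:R * D%:R} ->
    `|\sum_(a <- t) ln (1 + a) - \sum_(a <- t) Q.[a]| <= eps / 2%:R.
  move=> tv tP; rewrite -sumrB (le_trans (ler_norm_sum _ _ _)) //.
  apply: (@le_trans _ _ (\sum_(a <- t) (eps / (2%:R * v%:R)))).
    by rewrite big_seq [leRHS]big_seq ler_sum // => a /tP/QP.
  rewrite big_const_seq count_predT iter_addr_0.
  have [v0|v0] := posnP v.
    by move: tv; rewrite v0 leqn0 => /eqP ->; rewrite mulr0n divr_ge0 // ltW.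
  have vR : v%:R != 0 :> R by rewrite pnatr_eq0 -lt0n.
  have -> : eps / 2%:R = eps / (2%:R * v%:R) * v%:R by field.
  rewrite -[leLHS]mulr_natr ler_wpM2l ?ler_nat //.
  by rewrite divr_ge0 ?mulr_ge0 ?ler0n // ltW.
have eqQ : \sum_(a <- s) Q.[a] = \sum_(a <- s') Q.[a].
  rewrite !(sum_horner_power_sum _ sQ Q0); apply: eq_big_nat => i iK.
  congr (_ * _); apply: (@eq_power_sum R K) => // k kK.
  by rewrite -sE -sE' !coef_matching_poly eqm.
have := err s; rewrite -Tv -eD => /(_ ss sP) h.
have := err s'; rewrite -Tv' -eD' => /(_ ss' sP') h'.
rewrite eqQ in h.
move: h h'; set A := \sum_(a <- s) _; set B := \sum_(a <- s') ln _.
by rewrite !ler_norml => /andP[? ?] /andP[? ?]; apply/andP; split; lra.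
Qed.

Lemma cexp_ln (x : R) : 0 < x -> cexp (ln x)%:C = x%:C.
Proof. by move=> x0; rewrite /cexp /= cos0 sin0 lnK // mulr1. Qed.

Lemma nb_matchings_gt0 (T : finType) (e : rel T) : (0 < nb_matchings e)%N.
Proof.
rewrite card_gt0; apply/set0Pn; exists set0; rewrite inE /matching sub0set.
by apply/trivIsetP => A B; rewrite inE.
Qed.

End Approx.

Theorem theorem1p2 (R : realType) :
  exists c : R, 0 < c /\
  forall (v Delta : nat) (eps : R),
    (1 <= v)%N -> 0 < eps -> eps < 1 ->
    let K := Num.truncn (c * Num.sqrt Delta%:R * ln (v%:R / eps)) in
    exists Phi : K.+1.-tuple nat -> R[i],
      (forall x, Phi x != 0) /\
      forall (T : finType) (e : rel T),
        simple_graph e -> #|T| = v -> max_degree e = Delta ->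
        approximates eps (nb_matchings e)%:R
          (Phi [tuple nb_kmatchings e k | k < K.+1]).
Proof.
exists 14%:R; split=> // v D eps v1 eps0 eps1 K.
pose realised (x : K.+1.-tuple nat) (n : nat) := exists (T : finType) (e : rel T),
  [/\ simple_graph e, #|T| = v, max_degree e = D,
      [tuple nb_kmatchings e k | k < K.+1] = x & nb_matchings e = n].
(* By choice, [N x] is the number of matchings of some graph with parameters v, D and counts [x] if
   there is one; otherwise it is merely positive, which keeps Phi nonzero. *)
have /choice[N NP] : forall x : K.+1.-tuple nat, exists n : nat, (0 < n)%N /\
    forall m, realised x m -> realised x n.
  move=> x; have [[n xn]|no] := pselect (exists n, realised x n).
    exists n; split=> //; case: xn => T [e [_ _ _ _ <-]].
    exact: nb_matchings_gt0.
  by exists 1%N; split=> // m xm; case: no; exists m.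
exists (fun x => (N x)%:R); split=> [x|T e sg Tv eD].
  by rewrite pnatr_eq0 -lt0n; have [] := NP x.
set x := [tuple _ | _ < _]; have [Nx /(_ (nb_matchings e))] := NP x.
(* The value [N x] comes from a possibly different graph [e'] with the same m_0, ..., m_K. *)
case=> [|T' [e' [sg' Tv' eD' xE' NE]]]; first by exists T, e.
have natC n : (0 < n)%N -> n%:R = cexp (ln (n%:R : R))%:C.
  by move=> n0; rewrite cexp_ln ?ltr0n // rmorph_nat.
exists (ln (nb_matchings e)%:R)%:C, (ln (N x)%:R)%:C; split.
- exact/natC/nb_matchings_gt0.
- exact: natC.
(* Both logarithms are real, so the complex modulus is a real absolute value. *)
rewrite -rmorphB normc_def /= expr0n addr0 sqrtr_sqr lecR -NE.
apply: (@ln_nb_matchings_close R v D) => //; first by rewrite eps0.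
move=> k kK; have := congr1 (fun y : K.+1.-tuple nat => tnth y (inord k)) xE'.
by rewrite !tnth_mktuple inordK.
Qed.
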